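(* Let $K$ be a finite pure $k$-dimensional simplicial complex ($k\ge 1$) on the vertex set $[n]=\{1,\dots,n\}$. Then $$\sum_r \lambda_r(K)^2\ \le\ \sum_{r\ge1}\bigl(d^{\mathrm v,\mathsf T}_r(K)\bigr)^2 .$$ Moreover, equality holds if and only if $K$ is isomorphic to a shifted simplicial complex. More precisely, if equality holds and the vertices are labelled so that $\deg_K(1)\ge\deg_K(2)\ge\cdots\ge\deg_K(n)$, then $K$ is shifted in that labelling.
   Context: A simplicial complex $K$ on a finite vertex set is a collection of subsets closed under taking subsets; a face with $m+1$ vertices has dimension $m$, and $K_j$ is the set of $j$-dimensional faces. $K$ is $k$-dimensional if $k$ is the largest dimension of a face, and pure if every face lies in a $k$-face. Choose an orientation (an ordering of the vertices, up to even permutations) of each face. The boundary matrix $B_k=([\sigma:F])_{\sigma\in K_{k-1},F\in K_k}$ has $[\sigma:F]=0$ if $\sigma\not\subset F$, and if $F=[v_0,\dots,v_k]$ and $\sigma=F\setminus\{v_i\}$ then $[\sigma:F]=(-1)^i\operatorname{sgn}(\pi)$, where $\pi$ is the permutation carrying $(v_0,\dots,\widehat{v_i},\dots,v_k)$ to the chosen ordering of $\sigma$. The up-Laplacian is $L^{\mathrm{up}}_{k-1}(K)=B_kB_k^{\mathsf T}$; its spectrum does not depend on the orientations. $\lambda_1(K)\ge\lambda_2(K)\ge\cdots>0$ are its nonzero eigenvalues, counted with multiplicity. $\deg_K(v)=|\{\sigma\in K_k: v\in\sigma\}|$, and $d^{\mathrm v,\mathsf T}_r(K)=|\{i\in[n]:\deg_K(i)\ge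 r\}|$ for $r\ge1$. For $t$-element subsets $F=\{f_1<\cdots<f_t\}$ and $G=\{g_1<\cdots<g_t\}$ of $[n]$, write $F\le_P G$ if $f_r\le g_r$ for all $r$. A simplicial complex $K$ on $[n]$ is shifted if whenever $G\in K$, $F\subseteq[n]$, $|F|=|G|$ and $F\le_P G$, then $F\in K$. Isomorphic means equal after a bijective relabelling of the vertices. *)

(* Defs.v *)
From mathcomp Require Import all_boot all_order all_algebra all_fingroup.

Set Implicit Arguments.
Unset Strict Implicit.
Unset Printing Implicit Defensive.

Import Order.TTheory GRing.Theory Num.Theory.
Local Open Scope ring_scope.

(* The vertex set [n] is 'I_n.  As usual, the singletons are not required to
   be faces: a point of 'I_n lying in no face is allowed. *)

Definition simplicial_complex (n : nat) (K : {set {set 'I_n}}) : Prop :=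
  forall F G : {set 'I_n}, G \in K -> F \subset G -> F \in K.

Definition faces (n : nat) (K : {set {set 'I_n}}) (j : nat) : {set {set 'I_n}} :=
  [set F in K | #|F| == j.+1].

Definition dimensional (n k : nat) (K : {set {set 'I_n}}) : Prop :=
  faces K k != set0 /\ forall F, F \in K -> (#|F| <= k.+1)%N.

Definition pure (n k : nat) (K : {set {set 'I_n}}) : Prop :=
  forall F, F \in K -> exists2 G, G \in faces K k & F \subset G.

(* An orientation is given by a representative ordering of the vertices of
   each face. *)
Definition orientation (n : nat) (K : {set {set 'I_n}})
    (o : {set 'I_n} -> seq 'I_n) : Prop :=
  forall F, F \in K -> uniq (o F) /\ o F =i F.

(* Sign of the permutation of positions carrying the list s to the list t;
   this permutation is unique when s has no repetition.  The value 0 is a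
   junk value for lists that are not rearrangements of each other. *)
Definition carry_sgn (R : nzRingType) (T : eqType) (s t : seq T) : R :=
  if [pick p : 'S_(size s) | t == [seq tnth (in_tuple s) (p i) | i : 'I_(size s)]]
  is Some p then (-1) ^+ p else 0.

(* [sigma : F], where the position of v in the list o F is the index i
   such that v = v_i.  When #|F| = #|sigma| + 1, the inclusion of sigma in F
   means that sigma = F :\ v for a (unique) v in F. *)
Definition incidence (R : nzRingType) (n : nat) (o : {set 'I_n} -> seq 'I_n)
    (sigma F : {set 'I_n}) : R :=
  if [pick v in F | sigma == F :\ v] is Some v
  then (-1) ^+ index v (o F) * carry_sgn R (rem v (o F)) (o sigma) else 0.

Definition boundary_mx (R : nzRingType) (n k : nat) (K : {set {set 'I_n}})
    (o : {set 'I_n} -> seq 'I_n) : 'M[R]_(#|faces K k.-1|, #|faces K k|) :=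
  \matrix_(i, j) incidence R o (enum_val i) (enum_val j).

(* L^up_{k-1}(K), meant for k >= 1. *)
Definition up_laplacian (R : nzRingType) (n k : nat) (K : {set {set 'I_n}})
    (o : {set 'I_n} -> seq 'I_n) : 'M[R]_(#|faces K k.-1|) :=
  boundary_mx R k K o *m (boundary_mx R k K o)^T.

(* The eigenvalues with multiplicity, as roots of the characteristic
   polynomial. *)
Definition spectrum (C : closedFieldType) (m : nat) (A : 'M[C]_m) : seq C :=
  sval (closed_field_poly_normal (char_poly A)).

(* lambda_1(K) >= lambda_2(K) >= ... *)
Definition lambda (C : numClosedFieldType) (n k : nat) (K : {set {set 'I_n}})
    (o : {set 'I_n} -> seq 'I_n) : seq C :=
  sort >=%O [seq x <- spectrum (up_laplacian C k K o) | x != 0].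

Definition deg (n k : nat) (K : {set {set 'I_n}}) (v : 'I_n) : nat :=
  #|[set F in faces K k | v \in F]|.

Definition degT (n k : nat) (K : {set {set 'I_n}}) (r : nat) : nat :=
  #|[set i : 'I_n | (r <= deg k K i)%N]|.

(* The terms of the sum over r >= 1 vanish for r > #|K_k|, see degT_eq0. *)
Definition sum_degT_sqr (n k : nat) (K : {set {set 'I_n}}) : nat :=
  (\sum_(1 <= r < #|faces K k|.+1) degT k K r ^ 2)%N.

Lemma degT_eq0 (n k : nat) (K : {set {set 'I_n}}) (r : nat) :
  (#|faces K k| < r)%N -> degT k K r = 0%N.
Proof.
move=> lt_r; apply/eqP; rewrite cards_eq0; apply/eqP/setP=> i; rewrite !inE.
apply/negbTE; rewrite -ltnNge; apply: leq_ltn_trans lt_r.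
by apply: subset_leq_card; apply/subsetP=> F; rewrite inE => /andP[].
Qed.

(* F <=_P G: enum lists the elements of a subset of 'I_n in increasing order,
   and all2 forces both lists to have the same length. *)
Definition leP_set (n : nat) (F G : {set 'I_n}) : bool :=
  all2 (fun f g : 'I_n => (f <= g)%N) (enum F) (enum G).

Definition shifted (n : nat) (K : {set {set 'I_n}}) : Prop :=
  forall F G : {set 'I_n}, G \in K -> #|F| = #|G| -> leP_set F G -> F \in K.

Definition relabel (n : nat) (s : 'S_n) (K : {set {set 'I_n}}) :
  {set {set 'I_n}} := [set s @: F | F : {set 'I_n} in K].

Definition isomorphic (n : nat) (K K' : {set {set 'I_n}}) : Prop :=
  exists s : 'S_n, relabel s K = K'.

(* Main.v *)
(* The sum of the squared eigenvalues is tr ((B_k B_k^T)^2), the sum of the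
   squared entries of B_k^T B_k.  These entries are k+1 on the diagonal, +-1 for
   two k-faces that differ by exchanging one vertex, and 0 otherwise; so the sum
   counts the triples (i, j, F) such that F is a k-face containing i and the
   transposition (i j) carries F to a k-face (possibly F itself).  On the other
   side, the sum of the squared parts of the conjugate of the degree sequence is
   the sum over (i, j) of min (deg i) (deg j), and for fixed (i, j) the number of
   such F is at most deg i and, applying (i j), at most deg j.  Equality forces,
   for all i and j, that the vertex of smaller degree may always be exchanged for
   the other one; this is shiftedness for any labelling by decreasing degree. *)
Require Import Defs.
From mathcomp Require Import all_boot all_order all_algebra all_fingroup.
From mathcomp Require Import zify.

Set Implicit Arguments.
Unset Strict Implicit.
Unset Printing Implicit Defensive.

Import Order.TTheory GRing.Theory Num.Theory.
Local Open Scope ring_scope.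

(** * Squared eigenvalues as a trace *)

(** Since P(X - A) = (X - T)P, the two sides agree after multiplication by det P, which is
    nonzero. *)
Lemma char_poly_similar (F : fieldType) (m : nat) (P A T : 'M[F]_m) :
  P \in unitmx -> P *m A = T *m P -> char_poly A = char_poly T.
Proof.
move=> Pu PA; have /mulIf: \det (map_mx polyC P) != 0.
  by rewrite det_map_mx polyC_eq0 -unitfE -unitmxE.
apply; rewrite -[LHS]mulrC -!det_mulmx.
by rewrite mulmxBr mulmxBl -!map_mxM PA mul_scalar_mx mul_mx_scalar.
Qed.

Lemma trig_trace_sqr (R : comNzRingType) (m : nat) (T : 'M[R]_m) :
  is_trig_mx T -> \tr (T *m T) = \sum_i T i i ^+ 2.
Proof.
move=> /is_trig_mxP Ttrig; apply: eq_bigr => i _; rewrite mxE (bigD1 i) //=.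
rewrite big1 ?addr0 // => j; rewrite -val_eqE neq_ltn => /orP[]/Ttrig->.
  by rewrite mulr0.
by rewrite mul0r.
Qed.

Lemma exists_trigonalization (C : numClosedFieldType) (m : nat) (A : 'M[C]_m) :
  exists P T : 'M[C]_m, [/\ P \in unitmx, is_trig_mx T & P *m A = T *m P].
Proof.
case: m A => [|m] A.
  by exists 1%:M, A; rewrite unitmx1 mul1mx mulmx1 flatmx0 mx0_is_trig.
have [//|P /unitarymx_unit Pu Atrig] := Schur A.
by exists P, (conjmx P A); split; rewrite // conjumx // mulmxKV.
Qed.

(** Similarity preserves the trace of the square, and the diagonal of [T] is a rearrangement of the
    spectrum because both list the roots of one polynomial. *)
Lemma sum_spectrum_sqr (C : numClosedFieldType) (m : nat) (A : 'M[C]_m) :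
  \sum_(x <- spectrum A) x ^+ 2 = \tr (A *m A).
Proof.
have [P [T [Pu Ttrig PA]]] := exists_trigonalization A.
have ->: \tr (A *m A) = \tr (T *m T).
  have -> : T *m T = P *m (A *m A) *m invmx P.
    by rewrite mulmxA PA -[T *m P *m A]mulmxA PA mulmxA mulmxK.
  by rewrite [RHS]mxtrace_mulC mulKmx.
rewrite trig_trace_sqr // -(big_map (fun i => T i i) predT (fun x => x ^+ 2)).
apply/perm_big/prod_XsubC_eq.
rewrite big_map -char_poly_trig // -(char_poly_similar Pu PA) /spectrum.
case: closed_field_poly_normal => r /= ->.
by rewrite (monicP (char_poly_monic A)) scale1r.
Qed.

(** Zero eigenvalues add nothing; cyclicity of the trace moves from [B *m B^T] to the symmetric
    matrix [B^T *m B]. *)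
Lemma sum_lambda_sqr_trace (C : numClosedFieldType) (n k : nat)
    (K : {set {set 'I_n}}) (o : {set 'I_n} -> seq 'I_n) :
  let B := boundary_mx C k K o in
  \sum_(x <- lambda C k K o) x ^+ 2 =
    \sum_a \sum_b ((B^T *m B) a b) ^+ 2.
Proof.
move=> B; rewrite (perm_big _ (permEl (perm_sort _ _))) /= big_filter.
rewrite big_rmcond => [|x /negPn/eqP->]; last by rewrite expr0n.
rewrite sum_spectrum_sqr /up_laplacian -/B -mulmxA mxtrace_mulC -!mulmxA.
rewrite [B *m _]mulmxA -/B.
have -> : B^T *m (B *m B^T *m B) = (B^T *m B) *m (B^T *m B)^T.
  by rewrite trmx_mul trmxK !mulmxA.
apply: eq_bigr => a _; rewrite mxE; apply: eq_bigr => b _.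
by rewrite [X in _ * X]mxE expr2.
Qed.

(** * Entries of the Gram matrix [B^T *m B] *)

Lemma carry_sgn_sqr (R : nzRingType) (T : eqType) (s t : seq T) :
  perm_eq s t -> carry_sgn R s t ^+ 2 = 1.
Proof.
rewrite perm_sym /carry_sgn => /(@tuple_permP _ _ _ (in_tuple s))[p tE].
by case: pickP => [q _|/(_ p)/eqP//]; rewrite sqrr_sign.
Qed.

(** The support of [incidence]: the case in which its [pick] succeeds. *)
Definition facet (T : finType) (S F : {set T}) : bool :=
  [exists v in F, S == F :\ v].

Lemma facetP (T : finType) (S F : {set T}) :
  reflect (exists2 v, v \in F & S = F :\ v) (facet S F).
Proof.
by apply: (iffP exists_inP) => -[v vF /eqP SE]; exists v; rewrite ?SE.
Qed.

Lemma incidence_facet (R : nzRingType) (n : nat) (o : {set 'I_n} -> seq 'I_n)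
    (S F : {set 'I_n}) :
  ~~ facet S F -> incidence R o S F = 0.
Proof.
move/exists_inP=> nSF; rewrite /incidence; case: pickP => // v /andP[vF SF].
by case: nSF; exists v.
Qed.

(** Squaring removes the orientation signs, so they never have to be computed. *)
Lemma incidence_sqr (R : comNzRingType) (n : nat) (K : {set {set 'I_n}})
    (o : {set 'I_n} -> seq 'I_n) (S F : {set 'I_n}) :
  orientation K o -> S \in K -> F \in K ->
  incidence R o S F ^+ 2 = (facet S F)%:R.
Proof.
move=> oK SK FK; have [/exists_inP[v0 v0F SFv0]|/incidence_facet->] :=
  boolP (facet S F); last by rewrite expr0n.
rewrite /incidence; case: pickP => [v /andP[vF /eqP SF]|/(_ v0)]; last first.
  by rewrite /= v0F SFv0.
have [uF memF] := oK F FK; have [uS memS] := oK S SK.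
rewrite exprMn sqrr_sign mul1r carry_sgn_sqr //.
(* Both lists enumerate [S], so the junk value of [carry_sgn] does not occur. *)
apply: uniq_perm => // [|x]; first exact: rem_uniq.
by rewrite mem_rem_uniq // inE /= memF memS SF !inE.
Qed.

Lemma mem_imset_tperm (T : finType) (i j x : T) (F : {set T}) :
  (x \in tperm i j @: F) = (tperm i j x \in F).
Proof. by rewrite -{1}[x](tpermK i j) mem_imset //; apply: perm_inj. Qed.

Lemma imset_tpermK (T : finType) (i j : T) :
  involutive (fun F : {set T} => tperm i j @: F).
Proof. by move=> F; apply/setP=> x; rewrite !mem_imset_tperm tpermK. Qed.

Lemma imset_tperm_id (T : finType) (i j : T) (F : {set T}) :
  (i \in F) = (j \in F) -> tperm i j @: F = F.
Proof.
by move=> ij; apply/setP=> x; rewrite mem_imset_tperm; case: tpermP => [->|->|].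
Qed.

Lemma imset_tperm_setD1 (T : finType) (i j : T) (F : {set T}) :
  i \in F -> j \notin F -> tperm i j @: F :\ j = F :\ i.
Proof.
move=> iF jF; apply/setP=> x; rewrite !inE mem_imset_tperm.
case: tpermP => [->|->|/eqP/negPf-> /eqP/negPf->//].
  by rewrite eqxx (negPf jF) andbF.
by rewrite eqxx (negPf jF) andbF.
Qed.

Definition adjacent (T : finType) (F G : {set T}) : bool :=
  [exists i in F, [exists j in ~: F, G == tperm i j @: F]].

Lemma adjacentP (T : finType) (F G : {set T}) :
  reflect (exists i j, [/\ i \in F, j \notin F & G = tperm i j @: F])
          (adjacent F G).
Proof.
apply: (iffP exists_inP) => [[i iF /exists_inP[j]]|[i [j [iF jF ->]]]].
  by rewrite inE => jF /eqP->; exists i, j.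
by exists i => //; apply/exists_inP; exists j; rewrite ?inE.
Qed.

(** Writing F = S + u and G = S + v, the transposition of u and v carries F to G. *)
Lemma adjacent_facet (T : finType) (S F G : {set T}) :
  F != G -> facet S F -> facet S G -> adjacent F G.
Proof.
move=> neFG /facetP[u uF SFu] /facetP[v vG SGv].
have FE x : (x \in F) = (x == u) || (x \in S).
  by rewrite SFu !inE; case: eqVneq => // ->.
have GE x : (x \in G) = (x == v) || (x \in S).
  by rewrite SGv !inE; case: eqVneq => // ->.
have uS : u \in S = false by rewrite SFu !inE eqxx.
have vS : v \in S = false by rewrite SGv !inE eqxx.
have neuv : (u == v) = false.
  by apply/eqP=> uv; case/eqP: neFG; apply/setP=> x; rewrite FE GE uv.
apply/adjacentP; exists u, v; split=> //; first by rewrite FE vS eq_sym neuv.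
apply/setP=> x; rewrite mem_imset_tperm FE GE.
case: tpermP => [->|->|/eqP/negPf-> /eqP/negPf->//].
  by rewrite neuv uS eq_sym neuv vS.
by rewrite !eqxx.
Qed.

(** If the vertex removed from F is not i, then i lies in S, yet the exchanged face avoids i. With
    one common facet, the Gram sum has one term. *)
Lemma facet_tperm (T : finType) (S F : {set T}) (i j : T) :
  i \in F -> j \notin F ->
  facet S F && facet S (tperm i j @: F) = (S == F :\ i).
Proof.
move=> iF jF; apply/andP/eqP => [[/facetP[u uF SF] /facetP[v vG SG]]|->].
  suff -> : i = u by [].
  apply: contraNeq jF => neiu.
  have: i \in S by rewrite SF !inE neiu.
  by rewrite SG !inE mem_imset_tperm tpermL => /andP[].
split; apply/facetP; first by exists i.
by exists j; rewrite ?imset_tperm_setD1 // mem_imset_tperm tpermR.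
Qed.

Lemma card_facets (T : finType) (F : {set T}) :
  #|[set S | facet S F]| = #|F|.
Proof.
have -> : [set S | facet S F] = [set F :\ v | v in F].
  apply/setP=> S; rewrite inE.
  by apply/facetP/imsetP => -[v vF ->]; exists v.
apply: card_in_imset => u v uF vF /setP/(_ u).
by rewrite !inE eqxx uF andbT; case: eqVneq.
Qed.

Lemma facesP (n j : nat) (K : {set {set 'I_n}}) (F : {set 'I_n}) :
  reflect (F \in K /\ #|F| = j.+1) (F \in faces K j).
Proof. by rewrite inE; apply: (iffP andP) => -[FK /eqP]. Qed.

Lemma facet_face (n k : nat) (K : {set {set 'I_n}}) (S F : {set 'I_n}) :
  (0 < k)%N -> simplicial_complex K -> F \in faces K k -> facet S F ->
  S \in faces K k.-1.
Proof.
move=> k0 complexK /facesP[FK cF] /facetP[v vF ->].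
apply/facesP; split; first exact: complexK FK (subD1set _ _).
by move: cF; rewrite (cardsD1 v) vF prednK // => -[].
Qed.

(** On the diagonal the sum counts facets; for adjacent faces it has a single nonzero term, a
    product of two signs; otherwise every term vanishes. *)
Lemma gram_sqr (R : comNzRingType) (n k : nat) (K : {set {set 'I_n}})
    (o : {set 'I_n} -> seq 'I_n) (F G : {set 'I_n}) :
  (0 < k)%N -> simplicial_complex K -> orientation K o ->
  F \in faces K k -> G \in faces K k ->
  (\sum_(S in faces K k.-1) incidence R o S F * incidence R o S G) ^+ 2
    = (if F == G then (k.+1 ^ 2)%N else adjacent F G)%:R.
Proof.
move=> k0 complexK oK FX GX.
have [FK cF] := facesP _ _ _ FX; have [GK _] := facesP _ _ _ GX.
case: eqVneq => [<-|neFG].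
  under eq_bigr => S /facesP[SK _] do rewrite -expr2 (incidence_sqr _ oK) //.
  rewrite -natr_sum natrX; congr (_%:R ^+ 2).
  rewrite -cF -card_facets -sum1dep_card big_mkcond [RHS]big_mkcond.
  apply: eq_bigr => S _; case: (boolP (facet S F)) => [SF|_]; last by case: ifP.
  by rewrite (facet_face k0 complexK FX SF).
have [/adjacentP[i [j [iF jF GE]]]|nadj] := boolP (adjacent F G).
  have /andP[SF SG] : facet (F :\ i) F && facet (F :\ i) G.
    by rewrite GE facet_tperm.
  have SX := facet_face k0 complexK FX SF; have [SK _] := facesP _ _ _ SX.
  rewrite (bigD1 (F :\ i)) //= big1 => [|S /andP[_ neS]].
    by rewrite addr0 exprMn !(incidence_sqr _ oK) // SF SG mulr1.
  have: ~~ (facet S F && facet S G) by rewrite GE facet_tperm.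
  by rewrite negb_and => /orP[]/incidence_facet->; rewrite ?mul0r ?mulr0.
rewrite big1 ?expr0n // => S _.
have: ~~ (facet S F && facet S G).
  by apply: contra nadj => /andP[]; apply: adjacent_facet.
by rewrite negb_and => /orP[]/incidence_facet->; rewrite ?mul0r ?mulr0.
Qed.

(** * Counting exchanges of vertices *)

(** The vertex j may lie in F or equal i; such F are fixed and supply the diagonal terms of the Gram
    matrix. *)
Definition exchanges (T : finType) (X : {set {set T}}) (i j : T) :
    {set {set T}} :=
  [set F in X | (i \in F) && (tperm i j @: F \in X)].

(** The vertex i is recovered as the one that leaves F, and j as the one that enters. *)
Lemma imset_tperm_inj (T : finType) (F : {set T}) :
  {in setX F (~: F) &, injective (fun p : T * T => tperm p.1 p.2 @: F)}.
Proof.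
move=> [i j] [i' j'] /setXP[/= iF jF] /setXP[/= iF' jF'].
rewrite inE in jF; rewrite inE in jF'; move=> eqF.
congr pair.
  apply: contraTeq iF => neii; move/setP/(_ i): eqF.
  rewrite !mem_imset_tperm tpermL (negPf jF) => /esym/negbT.
  by case: tpermP neii => [->|->|//]; rewrite ?eqxx.
apply: contraNeq jF => nejj; move/setP/(_ j): eqF.
rewrite !mem_imset_tperm tpermR iF => /esym.
by case: tpermP nejj => [->|->|_ _ _ ->//]; rewrite ?eqxx.
Qed.

Lemma sum_tperm_adjacent (T : finType) (X : {set {set T}}) (F : {set T}) :
  (\sum_(i in F) \sum_(j in ~: F) (tperm i j @: F \in X)
    = \sum_(G in X) adjacent F G)%N.
Proof.
rewrite -big_mkcondr sum1dep_card pair_big_dep -big_mkcondr sum1dep_card /=.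
set D := [set _ | _].
rewrite -(card_in_imset (f := fun p => tperm p.1 p.2 @: F) (D := D)).
  apply: eq_card => G; rewrite inE; apply/imsetP/andP.
    case=> -[i j]; rewrite inE /= inE => /andP[/andP[iF jF] FX] ->.
    by split=> //; apply/adjacentP; exists i, j.
  case=> GX /adjacentP[i [j [iF jF GE]]]; exists (i, j) => //.
  by rewrite inE /= inE iF jF -GE.
apply: sub_in2 (@imset_tperm_inj _ F) => p.
by rewrite !inE => /andP[].
Qed.

(** For fixed F, each of the m vertices i of F has m choices of j in F, which fix F and give the
    term [m ^ 2]; the choices of j outside F give the adjacent faces. *)
Lemma sum_exchanges (T : finType) (X : {set {set T}}) (m : nat) :
  (forall F, F \in X -> #|F| = m) ->
  (\sum_i \sum_j #|exchanges X i j|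
    = \sum_(F in X) \sum_(G in X) (if F == G then m ^ 2 else adjacent F G))%N.
Proof.
move=> cardX; under eq_bigr => i _.
  under eq_bigr => j _ do rewrite -sum1_card big_mkcond.
  rewrite exchange_big; over.
rewrite exchange_big [RHS]big_mkcond; apply: eq_bigr => F _ /=.
case: ifP => FX; last first.
  by rewrite big1 // => i _; rewrite big1 // => j _; rewrite inE FX.
have nadjF : adjacent F F = false.
  apply/negbTE/negP => /adjacentP[i [j [iF /negPf jF /setP/(_ j)]]].
  by rewrite mem_imset_tperm tpermR iF jF.
have -> : (\sum_(G in X) (if F == G then m ^ 2 else adjacent F G)
           = m ^ 2 + \sum_(G in X) adjacent F G)%N.
  rewrite !(bigD1 F FX) /= eqxx nadjF add0n; congr addn.
  by apply: eq_bigr => G /andP[_]; rewrite eq_sym => /negPf->.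
rewrite -sum_tperm_adjacent -(cardX F FX) [LHS](bigID (mem F)) /=.
rewrite [X in (_ + X)%N]big1 ?addn0; last first.
  by move=> i /negPf iF; rewrite big1 // => j _; rewrite inE iF andbF.
rewrite -mulnn -sum_nat_const -big_split; apply: eq_bigr => i iF /=.
rewrite (bigID (mem F)) /=; congr addn.
  rewrite -sum1_card; apply: eq_bigr => j jF.
  by rewrite inE FX iF imset_tperm_id ?iF ?jF ?FX.
by apply: eq_big => j; rewrite !inE ?FX ?iF.
Qed.

(** * Comparison with the degrees *)

(** The order of the arguments matters: i leaves and j enters, so shiftedness concerns
    [exchangeable X j i] for i < j. *)
Definition exchangeable (T : finType) (X : {set {set T}}) (i j : T) : bool :=
  [forall F in X, (i \in F) ==> (tperm i j @: F \in X)].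

Lemma exchangeableP (T : finType) (X : {set {set T}}) (i j : T) :
  reflect (forall F, F \in X -> i \in F -> tperm i j @: F \in X)
          (exchangeable X i j).
Proof.
by apply: (iffP forall_inP) => exX F FX; [apply/implyP|apply/implyP]; apply: exX.
Qed.

(** The map F to [tperm i j @: F] is a bijection between the two sets. *)
Lemma card_exchangesC (T : finType) (X : {set {set T}}) (i j : T) :
  #|exchanges X i j| = #|exchanges X j i|.
Proof.
rewrite -(card_imset _ (inv_inj (@imset_tpermK _ i j))).
apply: eq_card => F; rewrite -[in LHS](imset_tpermK i j F) mem_imset.
  rewrite !inE mem_imset_tperm tpermL [tperm j i]tpermC imset_tpermK.
  by rewrite andbC -andbA [in RHS]andbCA.
exact: inv_inj (@imset_tpermK _ i j).
Qed.

Lemma card_exchanges_leqif (T : finType) (X : {set {set T}}) (i j : T) :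
  (#|exchanges X i j| <= #|[set F in X | i \in F]| ?= iff exchangeable X i j)%N.
Proof.
have sub : exchanges X i j \subset [set F in X | i \in F].
  by apply/subsetP=> F; rewrite !inE => /and3P[-> ->].
have -> : exchangeable X i j = ([set F in X | i \in F] \subset exchanges X i j).
  apply/exchangeableP/subsetP => [exX F|exX F FX iF].
    by rewrite !inE => /andP[FX iF]; rewrite FX iF exX.
  by have := exX F; rewrite !inE FX iF; apply.
exact: subset_leqif_card.
Qed.

(** By symmetry the count is at most either degree, so it equals the minimum exactly when it equals
    one of them. *)
Lemma card_exchanges_leqif_min (T : finType) (X : {set {set T}}) (i j : T) :
  (#|exchanges X i j|
    <= minn #|[set F in X | i \in F]| #|[set F in X | j \in F]|
    ?= iff exchangeable X i j || exchangeable X j i)%N.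
Proof.
have [lei eqi] := card_exchanges_leqif X i j.
have [lej eqj] := card_exchanges_leqif X j i.
rewrite (card_exchangesC X j i) in lej eqj.
split; first by rewrite leq_min lei.
rewrite -eqi -eqj; apply/eqP/orP => [->|].
  by rewrite /minn; case: ifP; rewrite eqxx; [left|right].
by move=> /orP; case: ltngtP lei lej => //; case: ltngtP => //; lia.
Qed.

(** The square of [degT] at r counts the pairs (i, j) whose degrees are both at least r; summing
    over r turns each pair into its minimum. *)
Lemma sum_degT_sqr_min (n k : nat) (K : {set {set 'I_n}}) :
  (sum_degT_sqr k K = \sum_i \sum_j minn (deg k K i) (deg k K j))%N.
Proof.
(* Cutting r off at [#|faces K k|] loses nothing, since no degree exceeds it ([deg_le]). *)
have sum_le (m : nat) : (m <= #|faces K k| ->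
    \sum_(1 <= r < #|faces K k|.+1) (r <= m) = m)%N.
  move=> le_m; rewrite big_add1 /= big_mkord.
  have {2}-> : (m = \sum_(r < m) 1)%N by rewrite sum_nat_const card_ord muln1.
  rewrite (big_ord_widen _ (fun=> 1%N) le_m) [RHS]big_mkcond.
  by apply: eq_bigr => r _; case: (r < m)%N.
have deg_le i : (deg k K i <= #|faces K k|)%N.
  by apply: subset_leq_card; apply/subsetP=> F; rewrite inE => /andP[].
have degTE r : degT k K r = (\sum_i (r <= deg k K i))%N.
  by rewrite /degT -sum1dep_card big_mkcond; apply: eq_bigr => i _; case: leqP.
rewrite /sum_degT_sqr.
under eq_bigr => r _ do rewrite degTE -mulnn big_distrlr /=.
rewrite exchange_big /=; apply: eq_bigr => i _.
rewrite exchange_big /=; apply: eq_bigr => j _.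
rewrite -[RHS]sum_le; last by rewrite geq_min deg_le.
apply: eq_bigr => r _; rewrite leq_min.
by rewrite mulnb.
Qed.

Lemma sum_lambda_sqr (C : numClosedFieldType) (n k : nat)
    (K : {set {set 'I_n}}) (o : {set 'I_n} -> seq 'I_n) :
  (0 < k)%N -> simplicial_complex K -> orientation K o ->
  \sum_(x <- lambda C k K o) x ^+ 2
    = (\sum_i \sum_j #|exchanges (faces K k) i j|)%:R.
Proof.
move=> k0 complexK oK; rewrite sum_lambda_sqr_trace.
rewrite (sum_exchanges (m := k.+1)) => [|F /facesP[]//].
rewrite natr_sum [RHS]big_enum_val; apply: eq_bigr => a _ /=.
rewrite natr_sum [RHS]big_enum_val; apply: eq_bigr => b _ /=.
rewrite -(gram_sqr C k0 complexK oK) ?enum_valP // mxE [in RHS]big_enum_val.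
by congr (_ ^+ 2); apply: eq_bigr => S _; rewrite !mxE.
Qed.

(** The bound holds term by term in (i, j), so equality of the sums means equality in every term. *)
Lemma sum_lambda_sqr_leqif (n k : nat) (K : {set {set 'I_n}}) :
  (\sum_i \sum_j #|exchanges (faces K k) i j| <= sum_degT_sqr k K
   ?= iff [forall i, forall j, exchangeable (faces K k) i j
                               || exchangeable (faces K k) j i])%N.
Proof.
rewrite sum_degT_sqr_min; apply: leqif_sum => i _; apply: leqif_sum => j _.
exact: card_exchanges_leqif_min.
Qed.

(** Either disjunct forces the exchange count to be the smaller degree, that of i, and this settles
    the direction of the exchange. *)
Lemma deg_exchangeable (n k : nat) (K : {set {set 'I_n}}) (i j : 'I_n) :
  exchangeable (faces K k) i j || exchangeable (faces K k) j i ->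
  (deg k K i <= deg k K j)%N -> exchangeable (faces K k) i j.
Proof.
move=> ex le_ij; have [_] := card_exchanges_leqif_min (faces K k) i j.
rewrite ex -/(deg k K i) -/(deg k K j) (minn_idPl le_ij) => eq_i.
by rewrite -(card_exchanges_leqif (faces K k) i j).2.
Qed.

(** * Shiftedness by single exchanges *)

Definition ord_ltn (n : nat) : rel 'I_n := fun i j => (i < j)%N.

Lemma pairwise_enum (n : nat) (F : {set 'I_n}) :
  pairwise (@ord_ltn n) (enum F).
Proof.
rewrite {1}/enum_mem -enumT; apply: pairwise_filter.
rewrite -(pairwise_map val (fun i j : nat => (i < j)%N)) val_enum_ord.
by rewrite -sorted_pairwise ?iota_ltn_sorted //; apply: ltn_trans.
Qed.

(** Comparing counts below x avoids computing the increasing enumeration of a set after an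
    exchange. *)
Lemma all2_leq_count (n : nat) (s t : seq 'I_n) :
  pairwise (@ord_ltn n) s -> pairwise (@ord_ltn n) t -> size s = size t ->
  (forall x : nat, (count (fun i : 'I_n => i < x) t
                    <= count (fun i : 'I_n => i < x) s)%N) ->
  all2 (fun f g : 'I_n => (f <= g)%N) s t.
Proof.
elim: s t => [|a s IHs] [|b t] //= /andP[as_ pws] /andP[bt pwt] [sz] cnt.
have count0 (c : 'I_n) (u : seq 'I_n) (x : nat) :
    all (ord_ltn c) u -> (x <= c)%N -> count (fun i : 'I_n => i < x)%N u = 0%N.
  move=> /allP cu xc; apply/eqP; rewrite -leqn0 leqNgt -has_count.
  by apply/hasPn => i /cu; rewrite /ord_ltn; lia.
have le_ab : (a <= b)%N.
  (* If b < a, then t has an entry below a, while s, being increasing with head a, has none. *)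
  rewrite leqNgt; apply/negP => lt_ba; have := cnt a.
  by rewrite (count0 a s) // ltnn lt_ba.
(* For the tails: if x <= b the tail of t has count 0; otherwise both heads are counted and
   cancel. *)
rewrite le_ab IHs // => x; have [xb|bx] := leqP x b; first by rewrite (count0 b).
by have := cnt x; rewrite bx (leq_ltn_trans le_ab bx).
Qed.

(** The transposition maps the elements of G below x injectively to elements below x: it lowers j to
    i and fixes the rest of G. *)
Lemma leP_set_tperm (n : nat) (G : {set 'I_n}) (i j : 'I_n) :
  (i < j)%N -> i \notin G -> leP_set (tperm i j @: G) G.
Proof.
move=> lt_ij iG; apply: all2_leq_count; rewrite ?pairwise_enum //.
  by rewrite -!cardE card_imset //; apply: perm_inj.
move=> x.
have countE (F : {set 'I_n}) :
    count (fun f : 'I_n => f < x)%N (enum F) = #|[set f in F | (f < x)%N]|.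
  rewrite -sum1_count big_enum_cond -sum1_card; apply: eq_bigl => f.
  by rewrite inE.
rewrite !countE -(card_imset _ (@perm_inj _ (tperm i j))).
apply: subset_leq_card; apply/subsetP=> _ /imsetP[f + ->].
rewrite !inE mem_imset_tperm tpermK => /andP[fG fx]; rewrite fG /=.
by case: tpermP fG fx => // [->|->]; [rewrite (negPf iG)|lia].
Qed.

Lemma shifted_exchangeable (n k : nat) (K : {set {set 'I_n}}) (i j : 'I_n) :
  shifted K -> (i < j)%N -> exchangeable (faces K k) j i.
Proof.
move=> shK lt_ij; apply/exchangeableP => F /facesP[FK cF] jF.
have cardE : #|tperm j i @: F| = #|F| by rewrite card_imset //; apply: perm_inj.
apply/facesP; split; last by rewrite cardE.
have [iF|iF] := boolP (i \in F); first by rewrite imset_tperm_id ?iF ?jF.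
by apply: (shK _ F) => //; rewrite tpermC leP_set_tperm.
Qed.

(* The entries of t are replaced by those of s from left to right, p being the
   part already treated; each step is a single exchange. *)
Lemma exchange_all2 (n : nat) (K : {set {set 'I_n}}) (p s t : seq 'I_n) :
  (forall (i j : 'I_n) F,
     (i < j)%N -> F \in K -> j \in F -> tperm j i @: F \in K) ->
  pairwise (@ord_ltn n) (p ++ s) -> pairwise (@ord_ltn n) (p ++ t) ->
  all2 (fun f g : 'I_n => (f <= g)%N) s t ->
  [set x in p ++ t] \in K -> [set x in p ++ s] \in K.
Proof.
move=> exK; elim: s p t => [|f s IHs] p [|g t] //= pws pwt /andP[le_fg le_st].
move: pws (pwt); rewrite !pairwise_cat /= !allrel_consr.
move=> /and3P[/andP[pf ps] pwp /andP[fs pws]].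
move=> /and3P[/andP[pg pt] _ /andP[gt pwt']] KG.
rewrite -cat_rcons; apply: (IHs _ t); rewrite // ?cat_rcons.
- by rewrite pairwise_cat /= allrel_consr pf ps pwp fs.
(* The modified list stays increasing since f <= g and g lies below t. *)
- rewrite pairwise_cat /= allrel_consr pf pt pwp pwt' !andbT.
  by apply: sub_all gt => x; apply: leq_ltn_trans.
have [->//|nefg] := eqVneq f g.
have lt_fg : (f < g)%N by rewrite ltn_neqAle le_fg andbT.
have notin (h : 'I_n) (u : seq 'I_n) : all (ord_ltn h) u -> h \notin u.
  by move=> /allP hu; apply/negP => /hu; rewrite /ord_ltn ltnn.
have notin' (h : 'I_n) (u : seq 'I_n) : all ((@ord_ltn n)^~ h) u -> h \notin u.
  by move=> /allP hu; apply/negP => /hu; rewrite /ord_ltn ltnn.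
(* As f occurs neither in p nor in t, exchanging g for f replaces just this entry. *)
have ft : f \notin t.
  by apply: notin; apply: sub_all gt => x; apply: ltn_trans.
have := exK f g _ lt_fg KG; rewrite inE mem_cat mem_head orbT => /(_ isT).
congr (_ \in K); apply/setP=> x; rewrite mem_imset_tperm !inE !mem_cat !inE.
case: tpermP => [->|->|/eqP/negPf-> /eqP/negPf->//].
  rewrite (negPf (notin' _ _ pf)) (negPf (notin' _ _ pg)) (negPf ft).
  by rewrite (negPf (notin _ _ gt)) (negPf nefg) eq_sym (negPf nefg).
by rewrite !eqxx !orbT.
Qed.

(** Purity extends exchanges from k-faces to all faces: a face H lies in a k-face, and the exchanged
    H lies in the exchanged k-face. *)
Lemma exchangeable_shifted (n k : nat) (K : {set {set 'I_n}}) :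
  simplicial_complex K -> pure k K ->
  (forall i j : 'I_n, (i < j)%N -> exchangeable (faces K k) j i) -> shifted K.
Proof.
move=> complexK pureK exK F G GK _ leFG.
have enumE (H : {set 'I_n}) : H = [set x in [::] ++ enum H].
  by apply/setP=> x; rewrite inE mem_enum.
rewrite [F]enumE; apply: (@exchange_all2 _ _ _ _ (enum G)); rewrite ?pairwise_enum //.
  move=> i j H lt_ij HK jH; have [H' H'X subH] := pureK H HK.
  have /exchangeableP/(_ _ H'X (subsetP subH _ jH))/facesP[tH'K _] :=
    exK _ _ lt_ij.
  exact: complexK tH'K (imsetS _ subH).
by rewrite -enumE.
Qed.

(** * Invariance under relabelling *)

Lemma mem_relabel (n : nat) (s : 'S_n) (K : {set {set 'I_n}}) (F : {set 'I_n}) :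
  (s @: F \in relabel s K) = (F \in K).
Proof. by rewrite mem_imset //; apply: imset_inj; apply: perm_inj. Qed.

Lemma faces_relabel (n k : nat) (s : 'S_n) (K : {set {set 'I_n}}) :
  faces (relabel s K) k = relabel s (faces K k).
Proof.
have cardE (F : {set 'I_n}) : #|s @: F| = #|F|.
  by rewrite card_imset //; apply: perm_inj.
apply/setP=> F; apply/facesP/imsetP => [[/imsetP[G GK ->]]|[G + ->]].
  by rewrite cardE => cG; exists G => //; apply/facesP.
by rewrite mem_relabel cardE => /facesP.
Qed.

(** Conjugating (i j) by s gives the transposition of s i and s j. *)
Lemma exchangeable_relabel (n k : nat) (s : 'S_n) (K : {set {set 'I_n}})
    (i j : 'I_n) :
  exchangeable (faces (relabel s K) k) (s i) (s j)
    = exchangeable (faces K k) i j.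
Proof.
have tpermE (F : {set 'I_n}) :
    tperm (s i) (s j) @: (s @: F) = s @: (tperm i j @: F).
  rewrite -!imset_comp; apply: eq_imset => x /=.
  by rewrite (inj_tperm _ _ _ (@perm_inj _ s)).
rewrite faces_relabel; apply/exchangeableP/exchangeableP => exK F.
  move=> FX iF; rewrite -(mem_relabel s) -tpermE.
  by apply: exK; rewrite ?mem_relabel ?imset_f.
move=> /imsetP[G GX ->]; rewrite mem_imset; last exact: perm_inj.
by move=> iG; rewrite tpermE mem_relabel exK.
Qed.

Lemma deg_relabel (n k : nat) (s : 'S_n) (K : {set {set 'I_n}}) (i : 'I_n) :
  deg k (relabel s K) (s i) = deg k K i.
Proof.
have inj_s : injective (fun F : {set 'I_n} => s @: F).
  by apply: imset_inj; apply: perm_inj.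
rewrite /deg faces_relabel -[RHS](card_imset _ inj_s); apply: eq_card => F.
rewrite inE; apply/andP/imsetP => [[/imsetP[G GX ->]]|[G + ->]].
  by rewrite mem_imset; [exists G; rewrite // inE GX|apply: perm_inj].
by rewrite inE mem_relabel mem_imset; [move/andP|apply: perm_inj].
Qed.

Lemma simplicial_relabel (n : nat) (s : 'S_n) (K : {set {set 'I_n}}) :
  simplicial_complex K -> simplicial_complex (relabel s K).
Proof.
move=> complexK F _ /imsetP[G GK ->] sub.
have [S subS ->] : exists2 S : {set 'I_n}, S \subset G & F = s @: S.
  exists (s @^-1: F).
    apply/subsetP=> x; rewrite inE => /(subsetP sub).
    by rewrite mem_imset //; apply: perm_inj.
  apply/setP=> x; rewrite -[x](permKV s) mem_imset; last exact: perm_inj.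
  by rewrite inE.
by rewrite mem_relabel (complexK _ G).
Qed.

Lemma pure_relabel (n k : nat) (s : 'S_n) (K : {set {set 'I_n}}) :
  pure k K -> pure k (relabel s K).
Proof.
move=> pureK _ /imsetP[F /pureK[G GX sub] ->]; exists (s @: G).
  by rewrite faces_relabel mem_relabel.
exact: imsetS.
Qed.

Lemma deg_sorting_perm (n k : nat) (K : {set {set 'I_n}}) :
  exists s : 'S_n, forall i j : 'I_n, (i <= j)%N ->
    (deg k (relabel s K) j <= deg k (relabel s K) i)%N.
Proof.
pose r := [rel i j : 'I_n | (deg k K j <= deg k K i)%N].
pose L := sort r (enum 'I_n).
have szL : size L == n by rewrite size_sort size_enum_ord.
have injL : injective (tnth (Tuple szL)).
  by apply/tuple_uniqP; rewrite /= sort_uniq enum_uniq.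
(* [perm injL] sends a position to the vertex listed there, so its inverse labels each vertex by its
   position. *)
exists (perm injL)^-1%g => i j le_ij.
have degE h : deg k (relabel (perm injL)^-1%g K) h = deg k K (nth i L h).
  by rewrite -{1}[h](permK (perm injL)) deg_relabel permE (tnth_nth i).
rewrite !degE.
have srtL : sorted r L by apply: sort_sorted => a b; apply: leq_total.
have r_tr : transitive r by move=> b a c ba cb; apply: leq_trans cb ba.
have r_refl : reflexive r by move=> a; apply: leqnn.
by apply: (sorted_leq_nth r_tr r_refl i srtL); rewrite // inE (eqP szL).
Qed.

Theorem theorem3p10 (C : numClosedFieldType) (n k : nat)
    (K : {set {set 'I_n}}) (o : {set 'I_n} -> seq 'I_n)
    (k_gt0 : (0 < k)%N) (complexK : simplicial_complex K)
    (dimK : dimensional k K) (pureK : pure k K) (orientK : orientation K o) :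
  [/\ \sum_(x <- lambda C k K o) x ^+ 2 <= (sum_degT_sqr k K)%:R,
      \sum_(x <- lambda C k K o) x ^+ 2 = (sum_degT_sqr k K)%:R <->
        (exists K' : {set {set 'I_n}},
           [/\ simplicial_complex K', shifted K' & isomorphic K K'])
    & \sum_(x <- lambda C k K o) x ^+ 2 = (sum_degT_sqr k K)%:R ->
      forall s : 'S_n,
        (forall i j : 'I_n, (i <= j)%N ->
           (deg k (relabel s K) j <= deg k (relabel s K) i)%N) ->
        shifted (relabel s K)].
Proof.
rewrite sum_lambda_sqr //; have [le_sum eq_sum] := sum_lambda_sqr_leqif k K.
set E := (_ = _ :> C).
have EP : E <-> forall i j,
    exchangeable (faces K k) i j || exchangeable (faces K k) j i.
  rewrite /E; split=> [/eqP|exK].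
    by rewrite eqr_nat eq_sum => /forallP exK i j; move: (exK i) => /forallP.
  apply/eqP; rewrite eqr_nat eq_sum.
  by apply/forallP => i; apply/forallP => j.
have sorted_shifted : E -> forall s : 'S_n,
    (forall i j : 'I_n, (i <= j)%N ->
       (deg k (relabel s K) j <= deg k (relabel s K) i)%N) ->
    shifted (relabel s K).
  move=> /EP exK s le_deg; apply: (@exchangeable_shifted _ k).
  - exact: simplicial_relabel.
  - exact: pure_relabel.
  (* After undoing the relabelling, the vertex labelled j has at most the degree of the one labelled
     i, so it may be exchanged for that one. *)
  move=> i j lt_ij; move: (le_deg i j (ltnW lt_ij)).
  rewrite -[i](permKV s) -[j](permKV s) !deg_relabel exchangeable_relabel.
  exact: deg_exchangeable.
split=> //; first by rewrite ler_nat.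
split=> [/sorted_shifted shK|[K' [_ shK [s KE]]]].
  have [s le_deg] := deg_sorting_perm k K; exists (relabel s K).
  by split; [exact: simplicial_relabel|exact: shK|exists s].
(* Conversely, of two distinct labels s i and s j the larger can be exchanged for the smaller in the
   shifted complex, and this pulls back to K. *)
rewrite -{K'}KE in shK; apply/EP => i j; rewrite -!(exchangeable_relabel k s K).
have [lt_ij|lt_ji|eq_ij] := ltngtP (s i) (s j).
- by rewrite (shifted_exchangeable k shK lt_ij) orbT.
- by rewrite (shifted_exchangeable k shK lt_ji).
have -> : i = j by apply: (@perm_inj _ s); apply: val_inj.
by rewrite orbb; apply/exchangeableP => F FX _; rewrite imset_tperm_id.
Qed.
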